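(* Let $D\subset\mathbb{C}^n$ be invariant with respect to complex conjugation. Let $f\in\mathcal{S}(\Omega_D)$, $h\in\{1,\dots,n\}$ and $H\in\mathcal{P}(n)$, with $p=\min H^c$ if $H\neq\{1,\dots,n\}$. Then: \begin{enumerate} \item $f^\circ_{s,H}\in\mathcal{S}_{c,H}(\Omega_D)\cap\mathcal{S}_p(\Omega_D)$ and $f'_{s,H}\in\mathcal{S}_{c,H}(\Omega_{D_H})\cap\mathcal{S}_p(\Omega_{D_H})$ (where the memberships in $\mathcal{S}_p$ are asserted only when $H\neq\{1,\dots,n\}$); \item if $f\in\mathcal{S}_h(\Omega_D)$, then $f'_{s,h}\in\mathcal{S}_{h+1}(\Omega_{D_h})\cap\mathcal{S}_{c,\{1,\dots,h\}}(\Omega_{D_h})$, where $\Omega_{D_h}=\Omega_D\setminus\mathbb{R}_h$ (the membership in $\mathcal{S}_{h+1}$ being asserted only when $h<n$); \item if $f\in\mathcal{S}_{c,h}(\Omega_D)$, then $f^\circ_{s,h}=f$ and $f'_{s,h}=0$; \item if $h\in H$, $H\cap\{1,\dots,h-1\}\neq\emptyset$ and $f\in\mathcal{S}_h(\Omega_D)$, then $f'_{s,H}=0$; \item $(f^\circ_{s,h})^\circ_{s,h}=f^\circ_{s,h}$ and $(f'_{s,h})'_{s,h}=0$. \end{enumerate}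
   Context: $\mathbb{H}$ is the algebra of quaternions, $\mathbb{S}_{\mathbb{H}}=\{q\in\mathbb{H}: q^2=-1\}$. $n\ge1$; $\mathcal{P}(n)$ is the set of subsets of $\{1,\dots,n\}$; $H^c=\{1,\dots,n\}\setminus H$. For $K=\{k_1<\dots<k_p\}\in\mathcal{P}(n)$ and quaternions $q_{k_1},\dots,q_{k_p}$, put $q_K=q_{k_1}\cdots q_{k_p}$ ($q_\emptyset=1$), and $[q_K,a]=q_K\,a$ for $a\in\mathbb{H}$. For $z\in\mathbb{C}^n$, $\overline{z}^h$ is $z$ with its $h$-th coordinate conjugated. $D\subset\mathbb{C}^n$ is invariant with respect to complex conjugation if $z\in D\iff\overline{z}^h\in D$ for every $h$. Its circularization is $\Omega_D=\{(\alpha_l+J_l\beta_l)_{l=1}^n: (\alpha_l+i\beta_l)_{l=1}^n\in D,\ J_1,\dots,J_n\in\mathbb{S}_{\mathbb{H}}\}\subset\mathbb{H}^n$. Let $\{e_K\}_{K\in\mathcal{P}(n)}$ be a basis of $\mathbb{R}^{2^n}$. A stem function is $F=\sum_{K}e_KF_K:D\to\mathbb{H}\otimes\mathbb{R}^{2^n}$, $F_K:D\to\mathbb{H}$, with $F_K(\overline{z}^h)=(-1)^{|K\cap\{h\}|}F_K(z)$ for all $K,h,z$. $F$ induces the slice function $f=\mathcal{I}(F):\Omega_D\to\mathbb{H}$, $f(x)=\sum_K[J_K,F_K(z)]$ for $x=(\alpha_l+J_l\beta_l)_l$, $z=(\alpha_l+i\beta_l)_l\in D$. $\mathcal{S}(\Omega_D)$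 is the set of slice functions; each slice function is induced by a unique stem function. One variable: for $E\subset\mathbb{C}$ conjugation invariant and $\Omega_E=\{\alpha+J\beta:\alpha+i\beta\in E, J\in\mathbb{S}_{\mathbb{H}}\}$, a function $g:\Omega_E\to\mathbb{H}$ is slice if $g(\alpha+J\beta)=G_1(\alpha+i\beta)+J\,G_2(\alpha+i\beta)$ for functions $G_1,G_2:E\to\mathbb{H}$ with $G_1(\overline w)=G_1(w)$, $G_2(\overline w)=-G_2(w)$. For $y\in\Omega_D$ let $\Omega_{D,h}(y)=\{x\in\mathbb{H}:(y_1,\dots,y_{h-1},x,y_{h+1},\dots,y_n)\in\Omega_D\}$ (a set of the form $\Omega_E$) and $f^y_h:\Omega_{D,h}(y)\to\mathbb{H}$, $f^y_h(x)=f(y_1,\dots,y_{h-1},x,y_{h+1},\dots,y_n)$. $\mathcal{S}_h(\Omega_D)$ is the set of $f\in\mathcal{S}(\Omega_D)$ such that $f^y_h$ is a one-variable slice function for every $y\in\Omega_D$. $\mathcal{S}_{c,h}(\Omega_D)$ is the set of $f\in\mathcal{S}(\Omega_D)$ such that for every $y\in\Omega_D$, $f^y_h$ is constant on $\{\alpha+I\beta: I\in\mathbb{S}_{\mathbb{H}}\}$, where $y_h=\alpha+J\beta$, $J\in\mathbb{S}_{\mathbb{H}}$. $\mathcal{S}_{c,H}(\Omega_D)=\bigcap_{h\in H}\mathcal{S}_{c,h}(\Omega_D)$ (understood as $\mathcal{S}(\Omega_D)$ if $H=\emptyset$). The same notation is used with $\Omega_D$ replaced by other circular sets. $\mathbb{R}_h$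 is the set of points whose $h$-th coordinate is real, $\mathbb{R}_H=\bigcup_{h\in H}\mathbb{R}_h$, and $\Omega_{D_H}=\Omega_D\setminus\mathbb{R}_H$. For $f=\mathcal{I}(F)$ and $H\in\mathcal{P}(n)$: $f^\circ_{s,H}=\mathcal{I}(F^\circ_H)\in\mathcal{S}(\Omega_D)$ with $F^\circ_H(z)=\sum_{K\subset H^c}e_KF_K(z)$, and $f'_{s,H}=\mathcal{I}(F'_H)\in\mathcal{S}(\Omega_{D_H})$ with $F'_H(z)=\beta_H^{-1}\sum_{K\subset H^c}e_KF_{K\cup H}(z)$ for $z\in D\setminus\mathbb{R}_H$, $z_l=\alpha_l+i\beta_l$, $\beta_H=\prod_{h\in H}\beta_h$. Write $f^\circ_{s,h}=f^\circ_{s,\{h\}}$, $f'_{s,h}=f'_{s,\{h\}}$. *)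

(* Defs.v *)
From HB Require Import structures.
From mathcomp Require Import all_boot all_order all_algebra.
From mathcomp Require Import boolp classical_sets reals complex ring.

Set Implicit Arguments.
Unset Strict Implicit.
Unset Printing Implicit Defensive.

Import Order.TTheory GRing.Theory Num.Theory.

Local Open Scope classical_set_scope.
Local Open Scope complex_scope.
Local Open Scope ring_scope.

(* [Quat a b c d] is a + b i + c j + d k. *)
Record quat (R : Type) := Quat { q_re : R; q_i : R; q_j : R; q_k : R }.

Section QuatChoice.
Variable R : choiceType.

Definition quat_to_prod (q : quat R) : R * R * R * R :=
  (q_re q, q_i q, q_j q, q_k q).
Definition quat_of_prod (t : R * R * R * R) : quat R :=
  let: (a, b, c, d) := t in Quat a b c d.

Lemma quat_to_prodK : cancel quat_to_prod quat_of_prod.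
Proof. by case. Qed.

HB.instance Definition _ := Choice.copy (quat R) (can_type quat_to_prodK).

End QuatChoice.

Section QuatAlgebra.
Variable R : comNzRingType.
Implicit Types (p q r : quat R) (a : R).

Definition quat_zero : quat R := Quat 0 0 0 0.
Definition quat_one : quat R := Quat 1 0 0 0.
Definition quat_opp q : quat R := Quat (- q_re q) (- q_i q) (- q_j q) (- q_k q).
Definition quat_add p q : quat R :=
  Quat (q_re p + q_re q) (q_i p + q_i q) (q_j p + q_j q) (q_k p + q_k q).
Definition quat_mul p q : quat R :=
  Quat (q_re p * q_re q - q_i p * q_i q - q_j p * q_j q - q_k p * q_k q)
       (q_re p * q_i q + q_i p * q_re q + q_j p * q_k q - q_k p * q_j q)
       (q_re p * q_j q - q_i p * q_k q + q_j p * q_re q + q_k p * q_i q)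
       (q_re p * q_k q + q_i p * q_j q - q_j p * q_i q + q_k p * q_re q).
Definition quat_scale a q : quat R :=
  Quat (a * q_re q) (a * q_i q) (a * q_j q) (a * q_k q).

Lemma quat_addA : associative quat_add.
Proof. by move=> p q r; rewrite /quat_add /= !addrA. Qed.
Lemma quat_addC : commutative quat_add.
Proof.
by move=> p q; rewrite /quat_add; congr Quat; rewrite addrC.
Qed.
Lemma quat_add0 : left_id quat_zero quat_add.
Proof. by case=> a b c d; rewrite /quat_add /= !add0r. Qed.
Lemma quat_addN : left_inverse quat_zero quat_opp quat_add.
Proof. by case=> a b c d; rewrite /quat_add /= !addNr. Qed.

HB.instance Definition _ := GRing.isZmodule.Build (quat R)
  quat_addA quat_addC quat_add0 quat_addN.

Lemma quat_mulA : associative quat_mul.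
Proof. by move=> p q r; rewrite /quat_mul /=; congr Quat; ring. Qed.
Lemma quat_mul1 : left_id quat_one quat_mul.
Proof. by case=> a b c d; rewrite /quat_mul /=; congr Quat; ring. Qed.
Lemma quat_mulr1 : right_id quat_one quat_mul.
Proof. by case=> a b c d; rewrite /quat_mul /=; congr Quat; ring. Qed.
Lemma quat_mulDl : left_distributive quat_mul quat_add.
Proof. by move=> p q r; rewrite /quat_mul /=; congr Quat => /=; ring. Qed.
Lemma quat_mulDr : right_distributive quat_mul quat_add.
Proof. by move=> p q r; rewrite /quat_mul /=; congr Quat => /=; ring. Qed.
Lemma quat_one_neq0 : quat_one != quat_zero.
Proof. by apply/eqP => -[] /eqP; rewrite oner_eq0. Qed.

HB.instance Definition _ := GRing.Zmodule_isNzRing.Build (quat R)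
  quat_mulA quat_mul1 quat_mulr1 quat_mulDl quat_mulDr quat_one_neq0.

Lemma quat_scaleA a b q : quat_scale a (quat_scale b q) = quat_scale (a * b) q.
Proof. by rewrite /quat_scale /= !mulrA. Qed.
Lemma quat_scale1 : left_id 1 quat_scale.
Proof. by case=> a b c d; rewrite /quat_scale /= !mul1r. Qed.
Lemma quat_scaleDr : right_distributive quat_scale +%R.
Proof. by move=> a p q; congr Quat; rewrite mulrDr. Qed.
Lemma quat_scaleDl q : {morph quat_scale^~ q : a b / a + b}.
Proof. by move=> a b; congr Quat; rewrite mulrDl. Qed.

HB.instance Definition _ := GRing.Zmodule_isLmodule.Build R (quat R)
  quat_scaleA quat_scale1 quat_scaleDr quat_scaleDl.

Lemma quat_scaleAl a p q : a *: (p * q) = (a *: p) * q.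
Proof. by congr Quat => /=; ring. Qed.
Lemma quat_scaleAr a p q : a *: (p * q) = p * (a *: q).
Proof. by congr Quat => /=; ring. Qed.

HB.instance Definition _ := GRing.Lmodule_isLalgebra.Build R (quat R)
  quat_scaleAl.
HB.instance Definition _ := GRing.Lalgebra_isAlgebra.Build R (quat R)
  quat_scaleAr.

End QuatAlgebra.

Definition upd (T : Type) (n : nat) (y : 'rV[T]_n) (h : 'I_n) (x : T) :
  'rV[T]_n := \row_l (if l == h then x else y 0 l).

Section SliceFunctions.
Variable R : realType.
Local Notation H := (quat R).
Local Notation C := R[i].

Definition imag_unit : set H := [set q | q ^+ 2 = -1].

(* The quaternion alpha + J beta, for w = alpha + i beta. *)
Definition slice_pt (J : H) (w : C) : H :=
  (complex.Re w)%:A + complex.Im w *: J.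

Section SeveralVariables.
Variable n : nat.
(* Coordinates are indexed by 'I_n, i.e. from 0 instead of from 1. *)
Implicit Types (D : set 'rV[C]_n) (K Hs : {set 'I_n}) (h : 'I_n).

Definition conj_at h (z : 'rV[C]_n) : 'rV[C]_n := upd z h (conjc (z 0 h)).

Definition conj_invariant D : Prop := forall h z, D z <-> D (conj_at h z).

Definition imag_units (J : 'rV[H]_n) : Prop := forall l, imag_unit (J 0 l).

Definition slice_pts (J : 'rV[H]_n) (z : 'rV[C]_n) : 'rV[H]_n :=
  \row_l slice_pt (J 0 l) (z 0 l).

Definition circularization D : set 'rV[H]_n :=
  [set x | exists z J, [/\ D z, imag_units J & x = slice_pts J z]].

(* D \ R_Hs, where R_Hs is the set of the points having some real coordinate  *)
(* of index in Hs; its circularization is Omega_D \ R_Hs.                     *)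
Definition off_real D Hs : set 'rV[C]_n :=
  D `\` [set z | exists2 h, h \in Hs & complex.Im (z 0 h) = 0].

(* Functions on a subset of C^n or H^n are represented by total functions of  *)
(* which only the values on that subset are relevant.  A stem function        *)
(* sum_K e_K F_K is represented by the family of its components F_K.          *)
Definition stem_family := {set 'I_n} -> 'rV[C]_n -> H.
Implicit Types (F : stem_family) (f : 'rV[H]_n -> H).

Definition is_stem D F : Prop := forall K h z, D z ->
  F K (conj_at h z) = (-1) ^+ #|K :&: [set h]| * F K z.

(* [q_K, a]; the product is taken in increasing order of the indices.         *)
Definition ord_mul (q : 'rV[H]_n) K (a : H) : H := (\prod_(k in K) q 0 k) * a.

Definition stem_value F (J : 'rV[H]_n) (z : 'rV[C]_n) : H :=
  \sum_(K : {set 'I_n}) ord_mul J K (F K z).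

Definition induces D F f : Prop := forall z J, D z -> imag_units J ->
  f (slice_pts J z) = stem_value F J z.

Definition slice D f : Prop := exists2 F, is_stem D F & induces D F f.

(* The function I(F).  If F is a stem function on D, then all the values in   *)
(* the set below are equal; outside of Omega_D the function is 0.             *)
Definition induced D F : 'rV[H]_n -> H := fun x =>
  xget 0 [set v | exists z J,
    [/\ D z, imag_units J, x = slice_pts J z & v = stem_value F J z]].

(* The stem function of a slice function, whose values on D are unique.       *)
Definition stem_of D f : stem_family :=
  xget (fun _ _ => 0) [set F | is_stem D F /\ induces D F f].

Definition conj_invariant1 (E : set C) : Prop := forall w, E w <-> E (conjc w).

Definition circularization1 (E : set C) : set H :=
  [set x | exists w J, [/\ E w, imag_unit J & x = slice_pt J w]].

Definition slice1 (X : set H) (g : H -> H) : Prop :=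
  exists E : set C, [/\ conj_invariant1 E, X = circularization1 E &
    exists G1 G2 : C -> H,
      (forall w, E w -> G1 (conjc w) = G1 w /\ G2 (conjc w) = - G2 w) /\
      (forall w J, E w -> imag_unit J ->
         g (slice_pt J w) = G1 w + J * G2 w)].

Definition section_dom D h (y : 'rV[H]_n) : set H :=
  [set x | circularization D (upd y h x)].

Definition section_fun f h (y : 'rV[H]_n) : H -> H := fun x => f (upd y h x).

Definition slice_in D h f : Prop := slice D f /\
  forall y, circularization D y ->
    slice1 (section_dom D h y) (section_fun f h y).

Definition circular_in D h f : Prop := slice D f /\
  forall y, circularization D y ->
    forall w J, imag_unit J -> y 0 h = slice_pt J w ->
      forall I1 I2, imag_unit I1 -> imag_unit I2 ->
        section_fun f h y (slice_pt I1 w) = section_fun f h y (slice_pt I2 w).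

Definition circular_in_all D Hs f : Prop := slice D f /\
  forall h, h \in Hs -> circular_in D h f.

Definition stem_sph_value Hs F : stem_family := fun K z =>
  if K \subset ~: Hs then F K z else 0.

Definition stem_sph_derivative Hs F : stem_family := fun K z =>
  if K \subset ~: Hs
  then (\prod_(h in Hs) complex.Im (z 0 h))^-1 *: F (K :|: Hs) z else 0.

Definition sph_value D Hs f : 'rV[H]_n -> H :=
  induced D (stem_sph_value Hs (stem_of D f)).

(* The derivative is a function on the circularization of [off_real D Hs].    *)
Definition sph_derivative D Hs f : 'rV[H]_n -> H :=
  induced (off_real D Hs) (stem_sph_derivative Hs (stem_of D f)).

End SeveralVariables.
End SliceFunctions.

(* Main.v *)
Require Import Defs.
From mathcomp Require Import all_boot all_order all_algebra.
From mathcomp Require Import boolp classical_sets reals complex ring.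

Set Implicit Arguments.
Unset Strict Implicit.
Unset Printing Implicit Defensive.

Import Order.TTheory GRing.Theory Num.Theory.

Local Open Scope classical_set_scope.
Local Open Scope complex_scope.
Local Open Scope ring_scope.

(** A slice function determines its stem function, and both circularity and
    one-variable sliceness of f = I(F) in coordinate h can be read on the
    components F_K, K a set of indices:
    - f is circular in h iff F_K = 0 whenever h is in K ([circular_inP]);
    - f is slice in h iff F_K = 0 whenever K contains h and some k < h
      ([slice_inP]).
    The first one holds because the change of J_h into - J_h negates the
    monomials J_K with h in K, and because the monomials are free
    ([monomials_free]).  For the second one, the monomials containing J_h are
    L J_h R with L the product of the units of smaller index; sliceness requires
    J_h to move to the left of L, which fails for suitable units unless L = 1.

    Given the two criteria, the proposition follows from looking at index sets.
    The stem functions of the spherical value and of the spherical derivative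
    with respect to H are supported on sets K disjoint from H, hence circularity
    in H; if p is the least element outside H, such a K has no element below p,
    hence sliceness in p.  The K-component of the derivative is F_{K :|: H} up
    to a real factor.  So if f is slice in h, the components of its derivative
    in h vanish for every K with an element k <= h, which gives the second
    claim; and if H contains both h and a smaller index, K :|: H always carries
    a zero component, which gives the fourth.  If f is circular in h, the
    components with h in K vanish, so that the spherical value keeps everything
    and the spherical derivative nothing; the last claim follows as the
    spherical value and derivative in h are themselves circular in h.

    To apply the criteria to functions of the form I(F), one needs that I(F) is
    well defined, although a point has several representations alpha + J beta
    ([slice_pts_eq]), and that its stem function is F again
    ([stem_of_induced]). *)

(** * Ordered products *)

(** Isolates the only factor of an ordered product that depends on the unit in
    coordinate h, without commuting anything past it. *)
Lemma prod_ord_split (A : pzSemiRingType) n (h : 'I_n) (K : {set 'I_n})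
    (F : 'I_n -> A) :
  \prod_(k in K) F k =
    (\prod_(k in K | (k < h)%N) F k) * (if h \in K then F h else 1) *
    \prod_(k in K | (h < k)%N) F k.
Proof.
have hin := mem_index_enum h.
have hsort : sorted ltn (map val (index_enum 'I_n)).
  by rewrite -[index_enum _]filter_predT deprecated_filter_index_enum
             val_enum_ord iota_ltn_sorted.
case/splitPr: hin hsort => s1 s2.
rewrite map_cat /= (sorted_pairwise ltn_trans) pairwise_cat /=.
case/and3P=> lt1 _ /andP[lt2 _].
have s1h k : k \in s1 -> (k < h)%N.
  move=> ks; move/allrelP: lt1 => /(_ _ _ (map_f val ks)); apply.
  by rewrite inE eqxx.
have hs2 k : k \in s2 -> (h < k)%N.
  by move=> ks; move/allP: lt2; apply; apply: map_f.
rewrite ![\prod_(k <- _ ++ _ | _) _]big_cat /= !big_cons !ltnn !andbF.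
have -> : \prod_(k <- s2 | (k \in K) && (k < h)%N) F k = 1.
  by rewrite big_seq_cond big1 // => k /and3P[/hs2 kh _]; rewrite ltnNge ltnW.
have -> : \prod_(k <- s1 | (k \in K) && (h < k)%N) F k = 1.
  by rewrite big_seq_cond big1 // => k /and3P[/s1h kh _]; rewrite ltnNge ltnW.
rewrite mulr1 mul1r.
have -> : \prod_(k <- s1 | k \in K) F k =
    \prod_(k <- s1 | (k \in K) && (k < h)%N) F k.
  rewrite big_seq_cond [RHS]big_seq_cond; apply: eq_bigl => k.
  by case: (boolP (k \in _)) => //= /s1h ->; rewrite andbT.
have -> : \prod_(k <- s2 | k \in K) F k =
    \prod_(k <- s2 | (k \in K) && (h < k)%N) F k.
  rewrite big_seq_cond [RHS]big_seq_cond; apply: eq_bigl => k.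
  by case: (boolP (k \in _)) => //= /hs2 ->; rewrite andbT.
by rewrite -mulrA; case: ifP => _; rewrite ?mul1r.
Qed.

(** * Changing one coordinate *)

Section Upd.
Variables (T : Type) (n : nat).
Implicit Types (y : 'rV[T]_n) (h : 'I_n).

Lemma upd_at y h x : upd y h x 0 h = x.
Proof. by rewrite mxE eqxx. Qed.

Lemma upd_off y h x l : l != h -> upd y h x 0 l = y 0 l.
Proof. by rewrite mxE => /negPf->. Qed.

Lemma upd_same y h : upd y h (y 0 h) = y.
Proof. by apply/rowP => l; rewrite mxE; case: eqP => [->|]. Qed.

Lemma upd_upd y h x x' : upd (upd y h x) h x' = upd y h x'.
Proof. by apply/rowP => l; rewrite !mxE; case: eqP. Qed.
End Upd.

(** * Imaginary units and the points of a slice *)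

Section Quaternions.
Variable R : realType.
Local Notation H := (quat R).
Implicit Types (I J p q : H) (v w : R[i]).

Lemma quat_double_eq0 q : q + q = 0 -> q = 0.
Proof.
move/eqP; rewrite -mulr2n -scaler_nat scaler_eq0 pnatr_eq0 /=.
by move/eqP.
Qed.

Lemma imag_unitN J : imag_unit J -> imag_unit (- J).
Proof. by rewrite /imag_unit /= sqrrN. Qed.

(** An imaginary unit is invertible, its inverse being its opposite. *)
Lemma imag_unit_cancel J q : imag_unit J -> J * q = 0 -> q = 0.
Proof.
move=> J2 /(congr1 (fun x => - (J * x))).
by rewrite mulr0 oppr0 mulrA -expr2 J2 mulN1r opprK.
Qed.

Lemma imag_unit_prod_cancel (X : Type) (s : seq X) (P : pred X) (F : X -> H) q :
  (forall k, imag_unit (F k)) -> (\prod_(k <- s | P k) F k) * q = 0 -> q = 0.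
Proof.
move=> FU; elim/big_rec: _ => [|k p _ IH]; first by rewrite mul1r.
by rewrite -mulrA => /(imag_unit_cancel (FU k)).
Qed.

(** If a is the real part of J and v its imaginary part, then J ^+ 2 has
    imaginary part 2 a v; so a <> 0 would force v = 0 and a ^+ 2 = -1. *)
Lemma imag_unit_re J : imag_unit J -> q_re J = 0.
Proof.
case: J => a b c d; rewrite /imag_unit /= expr2 => -[] /=.
move=> ha hb hc hd.
apply/eqP/negP => /negP a0.
have a2 : a * 2 != 0 by rewrite mulf_neq0 // pnatr_eq0.
have z x : a * x + x * a = 0 -> x = 0.
  rewrite (mulrC x) -mulr2n -mulr_natr mulrAC => /eqP.
  by rewrite mulf_eq0 (negPf a2) /= => /eqP.
have b0 : b = 0 by apply: z; rewrite -[RHS]oppr0 -hb; ring.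
have c0 : c = 0 by apply: z; rewrite -[RHS]oppr0 -hc; ring.
have d0 : d = 0 by apply: z; rewrite -[RHS]oppr0 -hd; ring.
have : 0 <= a * a by rewrite -expr2 sqr_ge0.
by move: ha; rewrite b0 c0 d0 !mulr0 !subr0 => ->; rewrite oppr_ge0 ler10.
Qed.

(** The representation of a quaternion as alpha + J beta is unique up to
    (beta, J) -> (- beta, - J), and J is arbitrary when beta = 0: the real part
    gives alpha, and squaring the imaginary part gives beta ^+ 2. *)
Lemma slice_ptP I J v w : imag_unit I -> imag_unit J ->
  slice_pt I v = slice_pt J w ->
  w = v /\ (I = J \/ complex.Im v = 0) \/ w = conjc v /\ J = - I.
Proof.
move=> IU JU; case: v => a b; case: w => c d; rewrite /slice_pt /= => e.
have ac : a = c.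
  move/(congr1 (@q_re R)): e => /=.
  by rewrite (imag_unit_re IU) (imag_unit_re JU) !mulr0 !addr0 !mulr1.
move: e; rewrite -{}ac => /addrI e.
have : b ^+ 2 = d ^+ 2.
  have sq (x : R) (K : H) : imag_unit K -> - q_re ((x *: K) ^+ 2) = x ^+ 2.
    by move=> KU; rewrite exprZn KU /= mulrN1 opprK.
  by rewrite -(sq b I) // -(sq d J) // e.
move/eqP; rewrite eqf_sqr => /orP[] /eqP bd.
  left; rewrite bd; split=> //.
  have [->|d0] := eqVneq d 0; first by right.
  by left; apply: (scalerI d0); rewrite -{1}bd.
have [d0|d0] := eqVneq d 0.
  by left; rewrite bd d0 oppr0; split => //; right.
right; rewrite bd opprK; split => //.
by apply: (scalerI d0); rewrite -e bd scalerN scaleNr.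
Qed.

Definition qi : H := Quat 0 1 0 0.
Definition qj : H := Quat 0 0 1 0.
Definition qk : H := Quat 0 0 0 1.

Lemma qi_unit : imag_unit qi.
Proof. by rewrite /imag_unit /= expr2; congr Quat => /=; ring. Qed.
Lemma qj_unit : imag_unit qj.
Proof. by rewrite /imag_unit /= expr2; congr Quat => /=; ring. Qed.
Lemma qk_unit : imag_unit qk.
Proof. by rewrite /imag_unit /= expr2; congr Quat => /=; ring. Qed.

(** A quaternion p anticommuting with i lies in the span of j and k, and
    conjugations by j and by k act on that plane by opposite reflections. *)
Lemma anticomm_qi_conj p : p * qi = - (qi * p) -> qj * p * qj + qk * p * qk = 0.
Proof.
have qkE : qk = qi * qj by congr Quat => /=; ring.
have qkE' : qk = - (qj * qi) by congr Quat => /=; ring.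
move=> e; rewrite {1}qkE' qkE !mulNr mulrA -(mulrA qj qi p) -[qi * p]opprK -e.
rewrite !mulrN !mulNr opprK -!mulrA [qi * (qi * _)]mulrA.
by rewrite -expr2 qi_unit mulN1r !mulrN addrN.
Qed.

(** Conjugation by i negates p, while those by j and by k add up to 0; if all
    conjugates of p by imaginary units agree after multiplication by q, then
    2 p q = 0. *)
Lemma anticomm_conj_const_eq0 p q :
  p * qi = - (qi * p) ->
  (forall I I', imag_unit I -> imag_unit I' ->
     I * p * I * q = I' * p * I' * q) ->
  p * q = 0.
Proof.
move=> pi pq; apply: quat_double_eq0.
have pE : p = qi * p * qi.
  by rewrite -mulrA pi mulrN mulrA -expr2 qi_unit mulN1r opprK.
rewrite {1 2}pE {1}(pq _ _ qi_unit qj_unit).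
rewrite (pq _ _ qi_unit qk_unit).
by rewrite -mulrDl anticomm_qi_conj ?mul0r.
Qed.

End Quaternions.

(** * Parity in the imaginary units and uniqueness of the stem function *)

Section Stems.
Variables (R : realType) (n : nat).
Local Notation H := (quat R).
Local Notation C := R[i].
Implicit Types (D : set 'rV[C]_n) (K M Hs : {set 'I_n}) (h k : 'I_n).
Implicit Types (F G : stem_family R n) (f : 'rV[H]_n -> H).
Implicit Types (J : 'rV[H]_n) (z : 'rV[C]_n).

Definition flip h J : 'rV[H]_n := upd J h (- J 0 h).

Lemma imag_units_upd J h I : imag_units J -> imag_unit I ->
  imag_units (upd J h I).
Proof. by move=> JU IU l; rewrite mxE; case: eqP. Qed.

Lemma imag_units_flip h J : imag_units J -> imag_units (flip h J).
Proof. by move=> JU; apply: imag_units_upd => //; apply: imag_unitN. Qed.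

Lemma ord_mul_upd J h I K a :
  ord_mul (upd J h I) K a =
    (\prod_(k in K | (k < h)%N) J 0 k) * (if h \in K then I else 1) *
    (\prod_(k in K | (h < k)%N) J 0 k) * a.
Proof.
rewrite /ord_mul (prod_ord_split h K) upd_at.
have off (P : pred 'I_n) : (forall k, P k -> k != h) ->
    \prod_(k in K | P k) upd J h I 0 k = \prod_(k in K | P k) J 0 k.
  by move=> Ph; apply: eq_bigr => k /andP[_ /Ph kh]; apply: upd_off.
by rewrite !off // => k kh; rewrite -val_eqE neq_ltn kh ?orbT.
Qed.

Lemma ord_mul_flip h J K a :
  ord_mul (flip h J) K a = (-1) ^+ (h \in K) * ord_mul J K a.
Proof.
rewrite -{2}(upd_same J h) !ord_mul_upd; case: (h \in K); last by rewrite mul1r.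
by rewrite expr1 mulN1r mulrN !mulNr.
Qed.

Lemma ord_mul_eq0 J K a : imag_units J -> ord_mul J K a = 0 -> a = 0.
Proof. by move=> JU; apply: imag_unit_prod_cancel. Qed.

(** The sign flips of J_1, ..., J_n act on the terms T K through 2 ^ n distinct
    characters, indexed by K, so a vanishing sum has vanishing terms.  Averaging
    over the flip at h, with the sign prescribed by M, keeps exactly those terms
    whose K agrees with M at h; doing this at every h leaves the term at M. *)
Lemma parity_filter (T : {set 'I_n} -> 'rV[H]_n -> H) :
  (forall K h J, imag_units J -> T K (flip h J) = (-1) ^+ (h \in K) * T K J) ->
  (forall J, imag_units J -> \sum_K T K J = 0) ->
  forall K J, imag_units J -> T K J = 0.
Proof.
move=> Tflip Tsum M.
pose agree (s : seq 'I_n) (K : {set 'I_n}) :=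
  all (fun l => (l \in K) == (l \in M)) s.
suff partial s J : imag_units J -> \sum_(K | agree s K) T K J = 0.
  move=> J JU; rewrite -(partial (enum 'I_n) J JU) (big_pred1 M) // => K.
  apply/allP/eqP => [KM|-> //].
  by apply/setP => l; apply/eqP/KM; rewrite mem_enum.
elim: s J => [|h s IH] J JU; first exact: Tsum.
apply: quat_double_eq0.
transitivity (\sum_(K | agree s K) T K J +
              (-1) ^+ (h \in M) * \sum_(K | agree s K) T K (flip h J)).
  rewrite mulr_sumr -!big_split /=.
  rewrite [LHS](eq_bigl (fun K => agree s K && ((h \in K) == (h \in M))));
    last by move=> K; rewrite /= andbC.
  rewrite big_mkcondr; apply: eq_bigr => K _.
  rewrite Tflip // mulrA -signr_addb.
  by case: (h \in K); case: (h \in M); rewrite /= ?mul1r ?mulN1r ?subrr.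
by rewrite !IH ?mulr0 ?addr0 //; apply: imag_units_flip.
Qed.

(** This makes the stem function of a slice function unique: a vector of
    coefficients is determined by the values it takes on all tuples J. *)
Lemma monomials_free (G : {set 'I_n} -> H) :
  (forall J, imag_units J -> \sum_K ord_mul J K (G K) = 0) -> forall K, G K = 0.
Proof.
move=> Gsum K; pose J0 : 'rV[H]_n := const_mx (qi R).
have J0U : imag_units J0 by move=> l; rewrite mxE; apply: qi_unit.
apply: (ord_mul_eq0 J0U (K := K)).
apply: (parity_filter (T := fun K J => ord_mul J K (G K))) => // M h J _.
exact: ord_mul_flip.
Qed.

(** * Stem functions induce slice functions *)

Lemma slice_pts_upd J z h I w :
  slice_pts (upd J h I) (upd z h w) = upd (slice_pts J z) h (slice_pt I w).
Proof. by apply/rowP => l; rewrite !mxE; case: eqP. Qed.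

Lemma card_setI1 K h : #|K :&: [set h]%SET| = (h \in K) :> nat.
Proof.
have -> : K :&: [set h]%SET = [set k in pred1 h | h \in K]%SET.
  apply/finset.setP => k; rewrite !inE.
  by case: eqP => [->|]; rewrite ?andbT ?andbF.
case: (h \in K) => /=.
  by rewrite -[RHS](cards1 h); apply: eq_card => k; rewrite !inE andbT.
by apply: eq_card0 => k; rewrite !inE andbF.
Qed.

(** A real coordinate is fixed by conjugation, and F K is odd in it. *)
Lemma stem_real_eq0 D F K h z : is_stem D F -> D z -> h \in K ->
  complex.Im (z 0 h) = 0 -> F K z = 0.
Proof.
move=> FS Dz hK z0; apply: quat_double_eq0.
have zE : conj_at h z = z.
  rewrite /conj_at -[RHS](upd_same z h); congr upd.
  by case: (z 0 h) z0 => a b /= ->; rewrite oppr0.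
by rewrite -{1}zE FS // card_setI1 hK mulN1r addNr.
Qed.

Lemma stem_value_real D F h I J z : is_stem D F -> D z ->
  complex.Im (z 0 h) = 0 -> stem_value F (upd J h I) z = stem_value F J z.
Proof.
move=> FS Dz z0; apply: eq_bigr => K _.
rewrite -{2}(upd_same J h) !ord_mul_upd.
by case: ifP => // hK; rewrite (stem_real_eq0 FS Dz hK z0) !mulr0.
Qed.

Lemma stem_value_flip D F h J z : is_stem D F -> D z ->
  stem_value F (flip h J) (conj_at h z) = stem_value F J z.
Proof.
move=> FS Dz; apply: eq_bigr => K _.
rewrite FS // card_setI1 ord_mul_flip /ord_mul.
by case: (h \in K); rewrite ?mul1r // !expr1 !mulN1r mulrN opprK.
Qed.

Lemma upd_dom D z h I I' w : conj_invariant D -> imag_unit I -> imag_unit I' ->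
  slice_pt I (z 0 h) = slice_pt I' w -> D z -> D (upd z h w).
Proof.
move=> hD IU IU' e Dz; case: (slice_ptP IU IU' e) => -[-> _].
  by rewrite upd_same.
exact/(hD h z).
Qed.

Lemma stem_value_upd D F J z h I w : is_stem D F -> D z ->
  imag_units J -> imag_unit I -> slice_pt (J 0 h) (z 0 h) = slice_pt I w ->
  stem_value F (upd J h I) (upd z h w) = stem_value F J z.
Proof.
move=> FS Dz JU IU e; case: (slice_ptP (JU h) IU e) => [[-> [JI|z0]]|[-> ->]].
- by rewrite upd_same -JI upd_same.
- by rewrite upd_same (stem_value_real _ _ FS).
- exact: stem_value_flip FS Dz.
Qed.

(** A point of the circularization has many representations (J, z), since each
    (J_l, z_l) may be replaced by (- J_l, conj z_l) and J_l is free when z_l is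
    real.  One representation is turned into another one coordinate at a time,
    and the parity of a stem function makes each step harmless. *)
Lemma slice_pts_eq D J z J' z' : conj_invariant D ->
  imag_units J -> imag_units J' -> slice_pts J z = slice_pts J' z' -> D z ->
  D z' /\ forall F, is_stem D F -> stem_value F J z = stem_value F J' z'.
Proof.
move=> hD JU JU' e Dz.
(* mix s takes the coordinates in s from the second representation. *)
pose mix T (a b : 'rV[T]_n) (s : seq 'I_n) :=
  \row_l (if l \in s then b 0 l else a 0 l).
have mixS T (a b : 'rV[T]_n) s l :
    mix T a b (l :: s) = upd (mix T a b s) l (b 0 l).
  by apply/rowP => k; rewrite !mxE inE; case: eqP => [->|].
have mix0 T (a b : 'rV[T]_n) : mix T a b [::] = a.
  by apply/rowP => k; rewrite mxE.
have mixT T (a b : 'rV[T]_n) : mix T a b (enum 'I_n) = b.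
  by apply/rowP => k; rewrite mxE mem_enum.
have mixU s : imag_units (mix _ J J' s) by move=> l; rewrite mxE; case: ifP.
rewrite -(mixT _ J J') -(mixT _ z z').
elim: (enum 'I_n) => [|l s [Ds Fs]]; first by rewrite !mix0.
have el : slice_pt (mix _ J J' s 0 l) (mix _ z z' s 0 l) =
    slice_pt (J' 0 l) (z' 0 l).
  rewrite !mxE; case: ifP => // _.
  by move/rowP: e => /(_ l); rewrite !mxE.
rewrite !mixS; split; first exact: upd_dom hD (mixU s l) (JU' l) el Ds.
by move=> F FS; rewrite (Fs F FS) (stem_value_upd FS Ds (mixU s) (JU' l) el).
Qed.

Lemma induced_induces D F : conj_invariant D -> is_stem D F ->
  induces D F (induced D F).
Proof.
move=> hD FS z J Dz JU; apply: xget_unique; first by exists z, J.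
move=> v [z' [J' [Dz' JU' e ->]]].
by have [_ ->] := slice_pts_eq hD JU' JU (esym e) Dz'.
Qed.

Lemma induced_slice D F : conj_invariant D -> is_stem D F ->
  slice D (induced D F).
Proof. by move=> hD FS; exists F => //; apply: induced_induces. Qed.

Lemma induces_inj D F G f : induces D F f -> induces D G f ->
  forall K z, D z -> F K z = G K z.
Proof.
move=> Ff Gf K z Dz; apply/eqP; rewrite -subr_eq0; apply/eqP.
apply: (monomials_free (G := fun K => F K z - G K z)) => J JU.
under eq_bigr do rewrite /ord_mul mulrBr.
by rewrite sumrB -[X in X - _]/(stem_value F J z) -Ff // Gf // subrr.
Qed.

Lemma eq_induces D F G f : (forall K z, D z -> F K z = G K z) ->
  induces D F f -> induces D G f.
Proof.
by move=> FG Ff z J Dz JU; rewrite Ff //; apply: eq_bigr => K _; rewrite FG.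
Qed.

Lemma induces_eq D F f g : induces D F f -> induces D F g ->
  forall x, circularization D x -> f x = g x.
Proof. by move=> Ff Fg x [z [J [Dz JU ->]]]; rewrite Ff ?Fg. Qed.

Lemma stem_ofP D f : slice D f ->
  is_stem D (stem_of D f) /\ induces D (stem_of D f) f.
Proof.
case=> F FS Ff.
exact: (@xgetI _ _ [set G | is_stem D G /\ induces D G f] F (conj FS Ff)).
Qed.

Lemma stem_of_induced D F : conj_invariant D -> is_stem D F ->
  forall K z, D z -> stem_of D (induced D F) K z = F K z.
Proof.
move=> hD FS; have [_ h2] := stem_ofP (induced_slice hD FS).
exact: induces_inj h2 (induced_induces hD FS).
Qed.

(** * Circularity and one-variable sliceness read on components *)

(** If f is circular in coordinate h, its value does not change when J_h is
    replaced by - J_h.  This change negates exactly the monomials J_K with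
    h in K, and by freeness of the monomials their coefficients vanish. *)
Lemma circular_inP D F f h : conj_invariant D -> is_stem D F -> induces D F f ->
  circular_in D h f <-> forall K z, h \in K -> D z -> F K z = 0.
Proof.
move=> hD FS Ff; split=> [[_ fc] K z hK Dz|F0].
  apply: quat_double_eq0.
  pose G (K : {set 'I_n}) := F K z - (-1) ^+ (h \in K) * F K z.
  suff : G K = 0 by rewrite /G hK mulN1r opprK.
  apply: monomials_free => J JU.
  have yD : circularization D (slice_pts J z) by exists z, J.
  have zh : slice_pts J z 0 h = slice_pt (J 0 h) (z 0 h) by rewrite mxE.
  have := fc _ yD _ _ (JU h) zh _ _ (JU h) (imag_unitN (JU h)).
  rewrite /section_fun -!slice_pts_upd !upd_same -/(flip h J).
  rewrite !Ff //; last exact: imag_units_flip.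
  move/eqP; rewrite -subr_eq0 -sumrB => /eqP e; rewrite -[RHS]e.
  apply: eq_bigr => M _; rewrite ord_mul_flip /G /ord_mul.
  case: (h \in M); rewrite ?expr1 ?mul1r ?subrr ?mulr0 //.
  by rewrite !mulN1r !opprK mulrDr.
split; first by exists F.
move=> y [z [J [Dz JU ->]]] w I IU; rewrite mxE => e I1 I2 I1U I2U.
have Dw := upd_dom hD (JU h) IU e Dz.
rewrite /section_fun -!slice_pts_upd !Ff //; try exact: imag_units_upd.
apply: eq_bigr => K _; rewrite !ord_mul_upd; case: ifP => // hK.
by rewrite (F0 K _ hK Dw) !mulr0.
Qed.

(** Conjugation invariance of D lets the representation of a point whose
    coordinates outside h are those of slice_pts J z be chosen with these
    coordinates given by z. *)
Lemma section_domE D J z h : conj_invariant D -> D z -> imag_units J ->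
  section_dom D h (slice_pts J z) = circularization1 [set w | D (upd z h w)].
Proof.
move=> hD Dz JU; apply/seteqP; split=> x.
  case=> z' [J' [Dz' JU' e]].
  have xE : x = slice_pt (J' 0 h) (z' 0 h).
    by move/rowP: e => /(_ h); rewrite upd_at mxE.
  exists (z' 0 h), (J' 0 h); split=> //=.
  rewrite xE -slice_pts_upd in e.
  have JhU := imag_units_upd h JU (JU' h).
  by have [] := slice_pts_eq hD JU' JhU (esym e) Dz'.
case=> w [I [/= Dw IU ->]]; exists (upd z h w), (upd J h I).
by rewrite slice_pts_upd; split=> //; apply: imag_units_upd.
Qed.

(** As a function of J_h = I, the monomial J_K with h in K is L I R, where L is
    the product of the units of index below h.  Sliceness asks for I to stand on
    the left.  It does if L = 1.  Conversely, if f is slice in coordinate h, the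
    odd part in I has the form I G2, so that multiplying it by I on the left
    gives a sum of terms I L I R F_K that does not depend on I.  The parity
    filter extends this to each term separately.  As soon as K contains some
    m < h, the other units can be chosen with L anticommuting with i, and then
    I L I R F_K cannot be independent of I unless F_K = 0. *)
Lemma slice_inP D F f h : conj_invariant D -> is_stem D F -> induces D F f ->
  slice_in D h f <->
  forall K z k, h \in K -> k \in K -> (k < h)%N -> D z -> F K z = 0.
Proof.
move=> hD FS Ff; split=> [[_ fs] M z m hM mM mh Dz|F0]; last first.
  split; first by exists F.
  move=> y [z [J [Dz JU ->]]]; exists [set w | D (upd z h w)]; split.
  - move=> w /=; rewrite (hD h (upd z h w)) /conj_at upd_upd upd_at.
    exact: iff_refl.
  - exact: section_domE.
  pose mono K w := (\prod_(k in K | (k < h)%N) J 0 k) *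
    (\prod_(k in K | (h < k)%N) J 0 k) * F K (upd z h w).
  exists (fun w => \sum_(K : {set 'I_n} | h \notin K) mono K w).
  exists (fun w => \sum_(K : {set 'I_n} | h \in K) mono K w); split=> w.
    move=> Dw; rewrite -sumrN.
    have conjE K :
        F K (upd z h (conjc w)) = (-1) ^+ (h \in K) * F K (upd z h w).
      by rewrite -card_setI1 -(FS K h _ Dw) /conj_at upd_upd upd_at.
    split; apply: eq_bigr => K hK; rewrite /mono conjE.
      by rewrite (negPf hK) mul1r.
    by rewrite hK mulN1r mulrN.
  move=> I Dw IU; rewrite /section_fun -slice_pts_upd.
  rewrite Ff //; last exact: imag_units_upd.
  rewrite /stem_value (bigID (fun K : {set 'I_n} => h \in K)) /=.
  rewrite addrC mulr_sumr.
  congr (_ + _); apply: eq_bigr => K hK; rewrite ord_mul_upd /mono.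
    by rewrite (negPf hK) mulr1.
  rewrite hK; case: (pickP [pred k | (k \in K) && (k < h)%N]) => [k|none].
    by case/andP=> kK kh; rewrite (F0 K _ k) // !mulr0.
  by rewrite big_pred0 // !mul1r mulrA.
have valE J I : imag_units J -> imag_unit I ->
    f (upd (slice_pts J z) h (slice_pt I (z 0 h))) =
    stem_value F (upd J h I) z.
  by move=> JU IU; rewrite -slice_pts_upd upd_same Ff //; apply: imag_units_upd.
pose S J I := \sum_(K : {set 'I_n} | h \in K) ord_mul (upd J h I) K (F K z).
(* S J I is the odd part of f in I, that is I G2, whence I S J I = - G2. *)
have const J I I' : imag_units J -> imag_unit I -> imag_unit I' ->
    I * S J I = I' * S J I'.
  move=> JU.
  have yD : circularization D (slice_pts J z) by exists z, J.
  have [E [Econj XE [G1 [G2 [_ GE]]]]] := fs _ yD.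
  have Ez : E (z 0 h).
    have : section_dom D h (slice_pts J z) (slice_pts J z 0 h).
      by rewrite /section_dom /= upd_same.
    rewrite XE mxE => -[w [I0 [Ew I0U e]]].
    case: (slice_ptP (JU h) I0U e) => -[wE _]; first by rewrite -wE.
    by rewrite (Econj (z 0 h)) -wE.
  suff main I0 : imag_unit I0 -> I0 * S J I0 = - G2 (z 0 h).
    by move=> IU IU'; rewrite !main.
  move=> I0U.
  suff -> : S J I0 = I0 * G2 (z 0 h) by rewrite mulrA -expr2 I0U mulN1r.
  apply/eqP; rewrite -subr_eq0; apply/eqP/quat_double_eq0.
  have SE : S J I0 + S J I0 =
      stem_value F (upd J h I0) z - stem_value F (upd J h (- I0)) z.
    rewrite -sumrB -big_split /= big_mkcond /=; apply: eq_bigr => K _.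
    rewrite !ord_mul_upd; case: (h \in K); last by rewrite subrr.
    by rewrite mulrN !mulNr opprK.
  rewrite addrACA SE -!valE //; last exact: imag_unitN.
  have := GE _ _ Ez I0U; have := GE _ _ Ez (imag_unitN I0U).
  rewrite /section_fun => -> ->.
  by rewrite mulNr opprB addrACA addrK addrAC subrr add0r subrr.
(* Neither I nor I' changes under the flip at h: the factor J 0 h is there to
   make T odd under that flip, as the parity filter requires. *)
pose T I I' K J := if h \in K then
  J 0 h * (I * ord_mul (upd J h I) K (F K z) -
           I' * ord_mul (upd J h I') K (F K z)) else 0.
have T0 I I' J : imag_unit I -> imag_unit I' -> imag_units J -> T I I' M J = 0.
  move=> IU IU'; apply: parity_filter => {J} [K l J JU|J JU]; last first.
    rewrite /T -big_mkcond -mulr_sumr sumrB -!mulr_sumr (const J I I') //.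
    by rewrite subrr mulr0.
  rewrite /T; case: ifP => hK; last by rewrite mulr0.
  have [->|lh] := eqVneq l h.
    by rewrite /flip !upd_upd upd_at hK mulN1r mulNr.
  have flipC X : upd (flip l J) h X = flip l (upd J h X).
    rewrite /flip (upd_off _ _ lh); apply/rowP => k; rewrite !mxE.
    by case: (eqVneq k h) => // ->; rewrite eq_sym (negPf lh).
  rewrite !flipC !ord_mul_flip upd_off 1?eq_sym //.
  by case: (l \in K); rewrite ?mul1r // !expr1 !mulN1r !mulrN -opprD mulrN.
(* With j in position m and i everywhere else, L has a single factor j. *)
pose J0 : 'rV[H]_n := \row_l (if l == m then qj R else qi R).
have J0U : imag_units J0.
  by move=> l; rewrite mxE; case: ifP => _; [apply: qj_unit | apply: qi_unit].
set L := \prod_(k in M | (k < h)%N) J0 0 k.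
have L_anti : L * qi R = - (qi R * L).
  have -> : L = \prod_(k in [set k in M | (k < h)%N]%SET) J0 0 k.
    by apply: eq_bigl => k; rewrite inE.
  rewrite (prod_ord_split m) inE mM mh /= mxE eqxx.
  have comm (P : pred 'I_n) : (forall k, P k -> k != m) ->
      GRing.comm (qi R) (\prod_(k | P k) J0 0 k).
    by move=> Pm; apply: commr_prod => k /Pm km; rewrite mxE (negPf km).
  rewrite -mulrA -[_ * qi R]comm; last first.
    by move=> k /andP[_ mk]; rewrite -val_eqE neq_ltn mk orbT.
  have ijN : qj R * qi R = - (qi R * qj R) by congr Quat => /=; ring.
  rewrite !mulrA -[_ * qj R * qi R]mulrA ijN mulrN mulrA.
  rewrite -[_ * qi R]comm; last first.
    by move=> k /andP[_ mk]; rewrite -val_eqE neq_ltn mk.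
  by rewrite !mulNr ?mulrA.
set r := \prod_(k in M | (h < k)%N) J0 0 k.
apply: (imag_unit_prod_cancel (s := index_enum _)
          (P := fun k => (k \in M) && (h < k)%N) J0U).
apply: (imag_unit_prod_cancel (s := index_enum _)
          (P := fun k => (k \in M) && (k < h)%N) J0U).
apply: anticomm_conj_const_eq0 => // I I' IU IU'.
apply/eqP; rewrite -subr_eq0; apply/eqP/(imag_unit_cancel (J0U h)).
have := T0 I I' J0 IU IU' J0U; rewrite /T hM !ord_mul_upd hM => T0J.
by rewrite -[RHS]T0J !mulrA.
Qed.

(** * The stem functions of the spherical value and derivative *)

Lemma off_real_conj D Hs : conj_invariant D -> conj_invariant (off_real D Hs).
Proof.
move=> hD h.
have sub z : off_real D Hs z -> off_real D Hs (conj_at h z).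
  case=> Dz zr; split; first exact/(hD h z).
  case=> k kH k0; apply: zr; exists k => //; move: k0; rewrite mxE.
  case: eqP => // ->; case: (z 0 h) => a b /= /eqP.
  by rewrite oppr_eq0 => /eqP.
move=> z; split=> /sub //; rewrite /conj_at upd_upd upd_at.
by rewrite conjcK upd_same.
Qed.

Lemma stem_sph_value_stem D F Hs :
  is_stem D F -> is_stem D (stem_sph_value Hs F).
Proof.
move=> FS K h z Dz; rewrite /stem_sph_value; case: ifP => _; first exact: FS.
by rewrite mulr0.
Qed.

Lemma prod_Im_conj z h Hs :
  \prod_(k in Hs) complex.Im (conj_at h z 0 k) =
    (-1) ^+ (h \in Hs) * \prod_(k in Hs) complex.Im (z 0 k).
Proof.
have ImE k :
    complex.Im (conj_at h z 0 k) = (-1) ^+ (k == h) * complex.Im (z 0 k).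
  rewrite mxE; case: eqP => [->|_]; rewrite ?mul1r // mulN1r.
  by case: (z 0 h).
under eq_bigr do rewrite ImE.
rewrite big_split /=; congr (_ * _); case: (boolP (h \in Hs)) => hH.
  rewrite (bigD1 h) //= eqxx big1 ?mulr1 // => k /andP[_ /negPf->] //.
by rewrite big1 // => k kH; case: eqP => // kh; rewrite -kh kH in hH.
Qed.

(** In a coordinate of Hs, the component F (K :|: Hs) and the product of the
    imaginary parts are both odd, so their quotient is even, as it has to be for
    K disjoint from Hs. *)
Lemma stem_sph_derivative_stem D F Hs : is_stem D F ->
  is_stem (off_real D Hs) (stem_sph_derivative Hs F).
Proof.
move=> FS K h z [Dz _]; rewrite /stem_sph_derivative card_setI1.
case: ifP => [KH|_]; last by rewrite mulr0.
rewrite FS // card_setI1 prod_Im_conj inE.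
have := fintype.subsetP KH h; rewrite inE.
case: (h \in K) => [/(_ isT) /negPf->|_] /=.
  by rewrite expr0 expr1 mul1r !mulN1r scalerN.
case: (h \in Hs); rewrite ?expr0 ?expr1 !mul1r //.
by rewrite !mulN1r invrN scaleNr scalerN opprK.
Qed.

Lemma stem_sph_value_eq0 Hs F K z k : k \in K -> k \in Hs ->
  stem_sph_value Hs F K z = 0.
Proof.
move=> kK kH; rewrite /stem_sph_value ifF //.
apply/negP => /fintype.subsetP /(_ _ kK).
by rewrite inE kH.
Qed.

Lemma stem_sph_derivative_eq0 Hs F K z k : k \in K -> k \in Hs ->
  stem_sph_derivative Hs F K z = 0.
Proof.
move=> kK kH; rewrite /stem_sph_derivative ifF //.
by apply/negP => /fintype.subsetP /(_ _ kK); rewrite inE kH.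
Qed.

Lemma stem_sph_derivative_top Hs F K z :
  (forall K', Hs \subset K' -> F K' z = 0) -> stem_sph_derivative Hs F K z = 0.
Proof.
move=> F0; rewrite /stem_sph_derivative; case: ifP => // _.
by rewrite F0 ?scaler0 // finset.subsetUr.
Qed.

Lemma stem_sph_value_id h F K z : (h \in K -> F K z = 0) ->
  stem_sph_value [set h]%SET F K z = F K z.
Proof.
rewrite /stem_sph_value -finset.disjoints_subset disjoint_sym disjoints1.
by case: (h \in K) => //= ->.
Qed.

Lemma induced_eq0 D F : conj_invariant D ->
  (forall K z, D z -> F K z = 0) ->
  forall x, circularization D x -> induced D F x = 0.
Proof.
move=> hD F0; have FS : is_stem D F.
  by move=> K h z Dz; rewrite !F0 ?mulr0 //; apply/(hD h z).
apply: induces_eq (induced_induces hD FS) _ => z J Dz _.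
by rewrite /stem_value big1 // => K _; rewrite F0 // /ord_mul mulr0.
Qed.

End Stems.

(** * The proposition *)

Theorem proposition4p4 (R : realType) (n : nat) (hn : (0 < n)%N)
    (D : set 'rV[R[i]]_n) (hD : conj_invariant D)
    (f : 'rV[quat R]_n -> quat R) (hf : slice D f)
    (h : 'I_n) (H : {set 'I_n}) :
  [/\ (circular_in_all D H (sph_value D H f) /\
       circular_in_all (off_real D H) H (sph_derivative D H f)) /\
      (forall p : 'I_n, p \in ~: H -> (forall k, k \in ~: H -> (p <= k)%N) ->
         slice_in D p (sph_value D H f) /\
         slice_in (off_real D H) p (sph_derivative D H f)),
      slice_in D h f ->
        (forall k : 'I_n, k = h.+1 :> nat ->
           slice_in (off_real D [set h]) k (sph_derivative D [set h] f)) /\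
        circular_in_all (off_real D [set h]) [set k : 'I_n | (k <= h)%N]%SET
          (sph_derivative D [set h] f),
      circular_in D h f ->
        (forall x, circularization D x -> sph_value D [set h] f x = f x) /\
        (forall x, circularization (off_real D [set h]) x ->
           sph_derivative D [set h] f x = 0),
      h \in H -> H :&: [set k : 'I_n | (k < h)%N]%SET != finset.set0 ->
        slice_in D h f ->
        forall x, circularization (off_real D H) x ->
          sph_derivative D H f x = 0
    & (forall x, circularization D x ->
         sph_value D [set h] (sph_value D [set h] f) x
           = sph_value D [set h] f x) /\
      (forall x, circularization (off_real D [set h]) x ->
         sph_derivative (off_real D [set h]) [set h]
           (sph_derivative D [set h] f) x = 0)].
Proof.
have [] := stem_ofP hf; set F := stem_of D f => FS Ff.
have hO Hs := off_real_conj Hs hD.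
have VS Hs := stem_sph_value_stem Hs FS.
have V_ind Hs := induced_induces hD (VS Hs).
have DS Hs := stem_sph_derivative_stem (Hs := Hs) FS.
have D_ind Hs := induced_induces (hO Hs) (DS Hs).
have h1 : h \in [set h]%SET by rewrite inE.
split.
- split.
    split; split; try exact: induced_slice.
      move=> k kH; apply/(circular_inP k hD (VS H) (V_ind H)) => K z kK _.
      exact: stem_sph_value_eq0 kK kH.
    move=> k kH; apply/(circular_inP k (hO H) (DS H) (D_ind H)) => K z kK _.
    exact: stem_sph_derivative_eq0 kK kH.
  move=> p _ pmin.
  have below (k : 'I_n) : (k < p)%N -> k \in H.
    move=> kp; apply: contraLR kp => kH; rewrite -leqNgt; apply: pmin.
    by rewrite inE.
  split.
    apply/(slice_inP p hD (VS H) (V_ind H)) => K z k _ kK /below kH _.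
    exact: stem_sph_value_eq0 kK kH.
  apply/(slice_inP p (hO H) (DS H) (D_ind H)) => K z k _ kK /below kH _.
  exact: stem_sph_derivative_eq0 kK kH.
- move=> /(slice_inP h hD FS Ff) F0.
  have D0 (K : {set 'I_n}) z k : k \in K -> (k <= h)%N ->
      off_real D [set h]%SET z ->
      stem_sph_derivative [set h]%SET F K z = 0.
    move=> kK; rewrite leq_eqVlt => /orP[/eqP/val_inj kh _|kh [Dz _]].
      by rewrite kh in kK; apply: stem_sph_derivative_eq0 kK h1.
    rewrite /stem_sph_derivative; case: ifP => // _.
    by rewrite (F0 _ _ k) ?scaler0 // !inE ?kK ?eqxx ?orbT.
  split=> [k kE|].
    apply/(slice_inP k (hO _) (DS _) (D_ind _)) => K z l _ lK.
    by rewrite kE ltnS; apply: D0.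
  split; first exact: induced_slice.
  move=> k; rewrite inE => kh.
  by apply/(circular_inP k (hO _) (DS _) (D_ind _)) => K z kK; apply: D0 kh.
- move=> /(circular_inP h hD FS Ff) F0; split.
    apply: induces_eq (V_ind _) _; apply: eq_induces Ff => K z Dz.
    by rewrite stem_sph_value_id // => hK; apply: F0.
  apply: induced_eq0 => // K z [Dz _]; apply: stem_sph_derivative_top => K'.
  by rewrite finset.sub1set => hK; apply: F0.
- move=> hH /set0Pn[k]; rewrite !inE => /andP[kH kh].
  move=> /(slice_inP h hD FS Ff) F0; apply: induced_eq0 => // K z [Dz _].
  apply: stem_sph_derivative_top => K' /fintype.subsetP HK.
  by apply: F0 kh Dz; apply: HK.
- split.
    have VVS := stem_sph_value_stem [set h]%SET
                  (stem_ofP (induced_slice hD (VS [set h]%SET))).1.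
    apply: induces_eq (induced_induces hD VVS) _; apply: eq_induces (V_ind _).
    move=> K z Dz; rewrite /sph_value [RHS]stem_sph_value_id stem_of_induced //.
    by move=> hK; apply: stem_sph_value_eq0 hK h1.
  have OO : off_real (off_real D [set h]%SET) [set h]%SET =
      off_real D [set h]%SET.
    by rewrite /off_real setDDl setUid.
  rewrite -[in X in circularization X]OO.
  apply: induced_eq0 => [|K z [Dz _]]; first exact/off_real_conj.
  apply: stem_sph_derivative_top => K'; rewrite finset.sub1set => hK.
  rewrite /sph_derivative stem_of_induced //.
  exact: stem_sph_derivative_eq0 hK h1.
Qed.
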